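(* Let $G$ be a compact group with identity $e$ and Haar probability measure $\nu$, let $A \subset G$ with $A = A^{-1}$ and $e \in A$, and let $W \leq G$ be a closed subgroup such that $wA = Aw = A$ for all $w \in W$. Let \[ B(G,A) = \inf\Big\{ h(e) : h \in C_{\succeq 0}(G) \text{ real-valued},\; h(g) \leq 0 \text{ for all } g \in A^c,\; \textstyle\int h\,d\nu = 1 \Big\}. \] Then $B(G,A)$ equals the infimum of the same problem with the additional constraint that $h(wg) = h(gw) = h(g)$ for all $g \in G$ and $w \in W$.
   Context: A continuous $f: G \to \mathbb{C}$ is positive definite ($f \in C_{\succeq 0}(G)$) if $\sum_{i,j=1}^n \overline{c_i} f(g_i^{-1} g_j) c_j \geq 0$ for all $n$, $g_i \in G$, $c_i\in\mathbb{C}$. $A^c$ is the complement of $A$ in $G$. *)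

(* Defs.v *)
From HB Require Import structures.
From mathcomp Require Import all_boot all_order all_algebra.
From mathcomp Require Import all_classical all_reals all_analysis.
From mathcomp Require Import complex.

Set Implicit Arguments.
Unset Strict Implicit.
Unset Printing Implicit Defensive.

Import Order.TTheory GRing.Theory Num.Theory.
Import numFieldNormedType.Exports.
Local Open Scope classical_set_scope.
Local Open Scope ring_scope.

(* A group carrying a topology (group structure from mathcomp's monoid.v,
   topology from mathcomp-analysis). The topological-group axioms are
   stated separately in [compact_group]. *)
#[short(type="groupTopType")]
HB.structure Definition GroupTop := {G of Group G & Pointed G & Topological G}.

Definition compact_group (G : groupTopType) : Prop :=
  [/\ hausdorff_space G,
      compact [set: G],
      continuous (fun p : G * G => (p.1 * p.2)%g) &
      continuous (fun x : G => (x^-1)%g)].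

Notation borel T := (g_sigma_algebraType (@open (T : ptopologicalType))).

Definition haar_probability (R : realType) (G : groupTopType)
    (nu : probability (borel G) R) : Prop :=
  [/\ (forall (g : G) (E : set (borel G)), measurable E ->
         nu [set (g * x)%g | x in E] = nu E),
      (forall E : set (borel G), measurable E ->
         nu E = ereal_sup [set nu K | K in [set K : set G | compact K /\ K `<=` E]]) &
      (forall E : set (borel G), measurable E ->
         nu E = ereal_inf [set nu U | U in [set U : set G | open U /\ E `<=` U]])].

Definition positive_definite (R : rcfType) (G : groupType) (f : G -> R[i]) : Prop :=
  forall (n : nat) (g : 'I_n -> G) (c : 'I_n -> R[i]),
    0 <= \sum_(i < n) \sum_(j < n) (c i)^* * f ((g i)^-1 * g j)%g * c j.

Definition real_pd (R : realType) (G : groupTopType) (h : G -> R) : Prop :=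
  continuous h /\ positive_definite (fun x => (h x)%:C%C).

Definition feasible (R : realType) (G : groupTopType)
    (nu : probability (borel G) R) (A : set G) (h : G -> R) : Prop :=
  [/\ real_pd h,
      (forall g, ~ A g -> h g <= 0) &
      (\int[nu]_x (h x)%:E = 1)%E].

(* B(G, A) (infimum in the extended reals; +oo if no feasible h). *)
Definition B_value (R : realType) (G : groupTopType)
    (nu : probability (borel G) R) (A : set G) : \bar R :=
  ereal_inf [set (h 1%g)%:E | h in feasible nu A].

Definition B_value_inv (R : realType) (G : groupTopType)
    (nu : probability (borel G) R) (A W : set G) : \bar R :=
  ereal_inf [set (h 1%g)%:E | h in [set h | feasible nu A h /\
     (forall (g w : G), W w -> h (w * g)%g = h g /\ h (g * w)%g = h g)]].

(* Main.v *)
Require Import Defs.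
From HB Require Import structures.
From mathcomp Require Import all_boot all_order all_algebra.
From mathcomp Require Import all_classical all_reals all_analysis.
From mathcomp Require Import complex.
From mathcomp Require Import ring lra.

Set Implicit Arguments.
Unset Strict Implicit.
Unset Printing Implicit Defensive.

Import Order.TTheory GRing.Theory Num.Theory.
Import numFieldNormedType.Exports.
Local Open Scope classical_set_scope.
Local Open Scope ring_scope.

(** In the GNS picture h(g) = <pi(g)xi, xi>, the symmetrised function is
    h'(g) = <pi(g)P xi, P xi> with P the projection onto the W-invariant
    vectors. P xi is the point of least norm in the closed convex hull of the
    orbit pi(W)xi, so no Haar measure on W is needed: by the parallelogram
    identity a minimising sequence x_n of convex combinations is Cauchy and
    asymptotically W-invariant, so that <pi(g)x_n, x_n> converges uniformly to
    a W-bi-invariant h'. Each <pi(g)x_n, x_n> is a finite convex combination of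
    the functions h(u^-1 g v) with u, v in W, hence is feasible with value at
    most h(e) at e, and so is h'. The invariance of the integral under right
    translations used here is obtained from left invariance by the same argument
    with W = G. *)

(** * The semi-inner product attached to a positive definite function *)

Section Gram.
Context {R : realType} {G : groupType}.
Implicit Types (h : G -> R) (s t : seq (R * G)) (W : set G).

(* A list of pairs (a, g) stands for the vector sum of the a pi(g)xi. *)
Definition gram h s t : R :=
  \sum_(p <- s) \sum_(q <- t) p.1 * q.1 * h (p.2^-1 * q.2)%g.

Definition wscale (a : R) s := [seq (a * p.1, p.2) | p <- s].
Definition wshift (g : G) s := [seq (p.1, (g * p.2)%g) | p <- s].
Definition wsub s t := s ++ wscale (-1) t.
(** Convolution of finitely supported measures: the operators pi(g) weighted by [t], applied to the
    vector of [s]. *)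
Definition wconv t s :=
  [seq (p.1 * q.1, (p.2 * q.2)%g) | p <- t, q <- s].

(** Real form of positive definiteness. Symmetry is a separate clause because real coefficients only
    see the symmetric part of [h]. *)
Definition sym_pd h : Prop :=
  (forall x, h (x^-1)%g = h x) /\ (forall s, 0 <= gram h s s).

(** Such lists represent the convex combinations of the orbit pi(W)xi. *)
Definition prob_on W s : Prop :=
  [/\ forall p, p \in s -> 0 <= p.1, forall p, p \in s -> W p.2 &
      \sum_(p <- s) p.1 = 1].

Lemma gram_catl h s1 s2 t : gram h (s1 ++ s2) t = gram h s1 t + gram h s2 t.
Proof. by rewrite /gram big_cat. Qed.

Lemma gram_catr h s t1 t2 : gram h s (t1 ++ t2) = gram h s t1 + gram h s t2.
Proof. by rewrite /gram -big_split; apply: eq_bigr => p _; rewrite big_cat. Qed.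

Lemma gram_scalel h a s t : gram h (wscale a s) t = a * gram h s t.
Proof.
rewrite /gram big_map mulr_sumr; apply: eq_bigr => p _.
by rewrite mulr_sumr; apply: eq_bigr => q _; rewrite !mulrA.
Qed.

Lemma gram_scaler h a s t : gram h s (wscale a t) = a * gram h s t.
Proof.
rewrite /gram mulr_sumr; apply: eq_bigr => p _; rewrite big_map mulr_sumr.
by apply: eq_bigr => q _ /=; rewrite !mulrA [p.1 * a]mulrC.
Qed.

(** Unitarity of pi(g): the factor [g] cancels in each p^-1 q. *)
Lemma gram_shift h g s t : gram h (wshift g s) (wshift g t) = gram h s t.
Proof.
rewrite /gram big_map; apply: eq_bigr => p _; rewrite big_map.
by apply: eq_bigr => q _ /=; rewrite invgM -mulgA mulKg.
Qed.

Lemma wshift1 s : wshift 1%g s = s.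
Proof. by elim: s => //= -[a g] s ->; rewrite mul1g. Qed.

Lemma wshiftM g1 g2 s : wshift (g1 * g2)%g s = wshift g1 (wshift g2 s).
Proof. by rewrite /wshift -map_comp; apply: eq_map => p /=; rewrite mulgA. Qed.

Lemma wshift_sub g s t : wshift g (wsub s t) = wsub (wshift g s) (wshift g t).
Proof. by rewrite /wshift /wsub /wscale map_cat -!map_comp. Qed.

Lemma gram_subl h s1 s2 t : gram h (wsub s1 s2) t = gram h s1 t - gram h s2 t.
Proof. by rewrite gram_catl gram_scalel mulN1r. Qed.

Lemma gram_subr h s t1 t2 : gram h s (wsub t1 t2) = gram h s t1 - gram h s t2.
Proof. by rewrite gram_catr gram_scaler mulN1r. Qed.

Lemma gramC h s t : (forall x, h (x^-1)%g = h x) -> gram h s t = gram h t s.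
Proof.
move=> hV; rewrite /gram exchange_big; apply: eq_bigr => q _.
apply: eq_bigr => p _; rewrite -[h (q.2^-1 * _)%g]hV invgM invgK.
by rewrite [p.1 * _]mulrC.
Qed.

(* AM-GM form of the Cauchy-Schwarz inequality for the semi-inner product. *)
Lemma gram_bound h (e M : R) s t : sym_pd h -> 0 < e ->
  gram h s s <= e ^+ 2 -> gram h t t <= M -> `|gram h s t| <= e * (1 + M) / 2.
Proof.
move=> [hV hP] e0 sE tM.
have P c : 0 <= gram h s s + 2 * c * gram h s t + c ^+ 2 * gram h t t.
  have := hP (s ++ wscale c t).
  rewrite gram_catl !gram_catr !gram_scalel !gram_scaler (gramC t s hV).
  by congr (_ <= _); ring.
(* The choice c = e or -e gives 2 e |<s,t>| <= e^2 + e^2 M, to be divided by 2 e. *)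
have := P e; have := P (- e) => P1 P2.
have M2 : e ^+ 2 * gram h t t <= e ^+ 2 * M by rewrite ler_wpM2l // sqr_ge0.
rewrite ler_norml; apply/andP; split; rewrite -(ler_pM2l e0); nra.
Qed.

(** The vectors xi + pi(x)xi and xi - pi(x)xi have nonnegative square norm. *)
Lemma sym_pd_le h x : sym_pd h -> `|h x| <= h 1%g.
Proof.
move=> [hV hP].
have P c : 0 <= h 1%g + 2 * c * h x + c ^+ 2 * h 1%g.
  have := hP [:: (1, 1%g); (c, x)].
  rewrite /gram !big_cons !big_nil /= !(invg1, mul1g, mulg1, mulVg) hV.
  by congr (_ <= _); ring.
have := P 1; have := P (- 1) => P1 P2.
by rewrite ler_norml; apply/andP; split; nra.
Qed.

Lemma prob_on_gram_le W h s : sym_pd h -> prob_on W s -> gram h s s <= h 1%g.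
Proof.
move=> hpd [s0 _ s1].
have -> : h 1%g = \sum_(p <- s) \sum_(q <- s) p.1 * q.1 * h 1%g.
  under eq_bigr do rewrite -mulr_suml -mulr_sumr s1 mulr1.
  by rewrite -mulr_suml s1 mul1r.
rewrite /gram big_seq [leRHS]big_seq; apply: ler_sum => p sp.
rewrite big_seq [leRHS]big_seq; apply: ler_sum => q sq.
apply: ler_wpM2l; first by rewrite mulr_ge0 ?s0.
by apply: le_trans (sym_pd_le _ hpd); exact: ler_norm.
Qed.

Lemma prob_on_dirac W : W 1%g -> prob_on W [:: (1, 1%g)].
Proof.
move=> W1; split => [p|p|]; last by rewrite big_seq1.
all: by rewrite inE => /eqP -> /=.
Qed.

Lemma prob_on_shift W g s : (forall w v, W w -> W v -> W (w * v)%g) ->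
  W g -> prob_on W s -> prob_on W (wshift g s).
Proof.
move=> WM Wg [s0 sW s1]; split; last by rewrite big_map.
- by move=> _ /mapP[p /s0 ? ->].
- by move=> _ /mapP[p /sW ? ->]; exact: WM.
Qed.

Lemma prob_on_mid W s t : prob_on W s -> prob_on W t ->
  prob_on W (wscale 2^-1 (s ++ t)).
Proof.
move=> [s0 sW s1] [t0 tW t1]; split.
- move=> _ /mapP[p + ->]; rewrite mem_cat /= => /orP[/s0|/t0] ?; lra.
- by move=> _ /mapP[p + ->]; rewrite mem_cat /= => /orP[/sW|/tW].
- by rewrite big_map -mulr_sumr big_cat /= s1 t1; lra.
Qed.

(* The parallelogram identity, applied to a minimising sequence for the norm. *)
Lemma min_gram_seq W h : sym_pd h -> W 1%g ->
  (forall w v, W w -> W v -> W (w * v)%g) ->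
  exists2 s : nat -> seq (R * G), forall n, prob_on W (s n) &
    forall n k w, (n <= k)%N -> W w ->
      gram h (wsub (wshift w (s k)) (s n)) (wsub (wshift w (s k)) (s n))
        <= (n.+1%:R^-1) ^+ 2.
Proof.
move=> hpd W1 WM; have [hV hP] := hpd.
pose E := [set gram h s s | s in prob_on W].
have E_inf : has_inf E.
  split; first by exists (gram h [:: (1, 1%g)] [:: (1, 1%g)]), [:: (1, 1%g)];
    [exact: prob_on_dirac|].
  by exists 0 => _ [s _ <-].
have infE s : prob_on W s -> inf E <= gram h s s.
  by move=> Ps; apply: ge_inf; [case: E_inf|exists s].
have near_inf n : exists s, prob_on W s /\
    gram h s s <= inf E + n.+1%:R^-1 ^+ 2 / 4.
  have e0 : 0 < n.+1%:R^-1 ^+ 2 / 4 :> R by rewrite divr_gt0 ?exprn_gt0.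
  by have [_ [s Ps <-] /ltW sE] := inf_adherent e0 E_inf; exists s.
have [s sP] := choice near_inf.
exists s => [n|n k w nk Ww]; first by have [] := sP n.
have [Pn sn] := sP n; have [Pk sk] := sP k.
set t := wshift w (s k).
have Pt : prob_on W t by exact: prob_on_shift.
have tE : gram h t t = gram h (s k) (s k) by exact: gram_shift.
(* The midpoint of [t] and [s n] is admissible, so its square norm is at least the infimum m. With a
   = 1/(n+1)^2 and b = 1/(k+1)^2, the slacks a/4 and b/4 give |t - s n|^2 <= 2(m + b/4) + 2(m + a/4)
   - 4m = (a + b)/2 <= a. *)
have := infE _ (prob_on_mid Pt Pn).
rewrite gram_subl !gram_subr gram_scalel gram_scaler gram_catl !gram_catr.
rewrite (gramC (s n) t hV) tE => mid.
have : k.+1%:R^-1 ^+ 2 <= n.+1%:R^-1 ^+ 2 :> R.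
  by rewrite lerXn2r ?nnegrE // lef_pV2 ?posrE // ler_nat.
move: sn sk mid.
move: (n.+1%:R^-1 ^+ 2) (k.+1%:R^-1 ^+ 2) (inf E) => a b m; lra.
Qed.

(** The matrix coefficient <pi(g)x, x> of the vector x represented by [s]. *)
Definition avg h s (g : G) : R := gram h s (wshift g s).

Lemma avg_sum h s g : avg h s g =
  \sum_(p <- s) \sum_(q <- s) p.1 * q.1 * h (p.2^-1 * g * q.2)%g.
Proof.
rewrite /avg /gram; apply: eq_bigr => p _; rewrite big_map.
by apply: eq_bigr => q _; rewrite mulgA.
Qed.

(** By unitarity <pi(vgw)s, s> = <pi(g)pi(w)s, pi(v^-1)s>, and both translates of [s] are within [e]
    of [t]. *)
Lemma avg_dist W h s t g (e : R) v w : sym_pd h -> 0 < e ->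
  prob_on W s -> prob_on W t ->
  (forall u, W u ->
     gram h (wsub (wshift u s) t) (wsub (wshift u s) t) <= e ^+ 2) ->
  W (v^-1)%g -> W w ->
  `|avg h s (v * g * w)%g - avg h t g| <= e * (1 + h 1%g).
Proof.
move=> hpd e0 Ps Pt close Wv Ww; have [hV _] := hpd.
have -> : avg h s (v * g * w)%g =
    gram h (wshift v^-1 s)%g (wshift g (wshift w s)).
  by rewrite -[RHS](gram_shift h v) -!wshiftM mulgV wshift1.
set x := wshift v^-1%g s; set y := wshift w s.
(* One argument is replaced by [t] at a time; each error is a pairing with a vector of square norm
   at most h(e), and costs half of the bound. *)
have -> : gram h x (wshift g y) - avg h t g =
    gram h (wsub x t) (wshift g y) + gram h (wshift g (wsub y t)) t.
  rewrite [gram h (wshift g (wsub y t)) t]gramC // wshift_sub gram_subl.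
  by rewrite gram_subr /avg; ring.
rewrite (le_trans (ler_normD _ _)) //.
have -> : e * (1 + h 1%g) = e * (1 + h 1%g) / 2 + e * (1 + h 1%g) / 2 by field.
apply: lerD; apply: gram_bound => //; rewrite ?gram_shift.
- exact: close.
- exact: prob_on_gram_le Ps.
- exact: close.
- exact: prob_on_gram_le Pt.
Qed.

(** Since u^-1 (p^-1 p') v = (p u)^-1 (p' v), averaging moves from the function to the test vector;
    positivity of [avg h s] follows. *)
Lemma gram_avg h s t : gram (avg h s) t t = gram h (wconv t s) (wconv t s).
Proof.
rewrite /gram big_allpairs_dep; apply: eq_bigr => p _.
under [RHS]eq_bigr do rewrite big_allpairs_dep.
rewrite exchange_big /=; apply: eq_bigr => p' _; rewrite avg_sum mulr_sumr.
apply: eq_bigr => q _; rewrite mulr_sumr; apply: eq_bigr => q' _.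
by rewrite invgM !mulgA; ring.
Qed.

Lemma sym_pd_avg h s : sym_pd h -> sym_pd (avg h s).
Proof.
move=> [hV hP]; split=> [x|t]; last by rewrite gram_avg.
by rewrite /avg -(gram_shift h x) -wshiftM mulgV wshift1 gramC.
Qed.

End Gram.

(** * Complex versus real positive definiteness *)

Lemma complex_sum (R : rcfType) I (r : seq I) (F : I -> R[i]) :
  \sum_(i <- r) F i =
  ((\sum_(i <- r) complex.Re (F i)) +i* (\sum_(i <- r) complex.Im (F i)))%C.
Proof.
elim: r => [|i r IH]; first by rewrite !big_nil.
by rewrite !big_cons IH; case: (F i).
Qed.

Lemma positive_definite_real (R : realType) (G : groupType) (h : G -> R) :
  positive_definite (fun x => (h x)%:C%C) <-> sym_pd h.
Proof.
split=> [hP|[hV hP] n g c].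
- split=> [x|s].
  (* For the points e, x with coefficients 1, i the form has imaginary part h(x) - h(x^-1), which
     must vanish. *)
  + have := hP 2%N (fun i => if i == ord0 then 1%g else x)
                   (fun i => if i == ord0 then 1 else 'i%C).
    rewrite !big_ord_recl !big_ord0 /= lecE => /andP[/eqP /= + _].
    rewrite !(invg1, mul1g, mulg1, mulVg) => H.
    by move: H; lra.
  + have := hP (size s) (fun i => (tnth (in_tuple s) i).2)
                   (fun i => (tnth (in_tuple s) i).1%:C%C).
    rewrite complex_sum lecE => /andP[_] /=; congr (_ <= _).
    rewrite /gram [RHS]big_tnth; apply: eq_bigr => i _.
    rewrite complex_sum [RHS]big_tnth; apply: eq_bigr => j _ /=; ring.
(* Real and imaginary parts of the coefficients give two real vectors; the cross terms cancel by
   symmetry. *)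
- pose s := [seq (complex.Re (c i), g i) | i <- index_enum 'I_n].
  pose t := [seq (complex.Im (c i), g i) | i <- index_enum 'I_n].
  have -> : \sum_(i < n) \sum_(j < n)
      (c i)^* * (h ((g i)^-1 * g j)%g)%:C%C * c j =
      ((gram h s s + gram h t t) +i* (gram h s t - gram h t s))%C.
    rewrite complex_sum; congr Complex.
    + rewrite /gram !big_map -big_split; apply: eq_bigr => i _.
      rewrite complex_sum /= !big_map -big_split; apply: eq_bigr => j _ /=.
      case: (c i) => a b; case: (c j) => a' b' /=; ring.
    + rewrite /gram !big_map -sumrB; apply: eq_bigr => i _.
      rewrite complex_sum /= !big_map -sumrB; apply: eq_bigr => j _ /=.
      case: (c i) => a b; case: (c j) => a' b' /=; ring.
  by rewrite lecE /= (gramC t s hV) subrr eqxx addr_ge0.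
Qed.

(** * Estimates at rate 1/(n+1), and integrals of finite sums *)

Section Limits.
Context {R : realType}.

Lemma cvg_invSn_mul (C : R) : (fun n : nat => n.+1%:R^-1 * C) @ \oo --> 0.
Proof.
rewrite -[X in _ --> X](mul0r C); apply: cvgM; last exact: cvg_cst.
exact: cvg_harmonic.
Qed.

Lemma invSn_mul_lt (C e : R) : 0 < e -> exists n : nat, n.+1%:R^-1 * C < e.
Proof.
move=> e0; have [n _ nP] := cvgr_lt _ (cvg_invSn_mul C) _ e0.
by exists n; apply: nP => /=.
Qed.

Lemma eq_of_invSn_mul (a b C : R) :
  (forall n : nat, `|a - b| <= n.+1%:R^-1 * C) -> a = b.
Proof.
move=> abC; apply/eqP; rewrite -subr_eq0 -normr_le0 leNgt.
by apply/negP => /(invSn_mul_lt C)[n]; rewrite ltNge abC.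
Qed.

Lemma Rintegral_bigsum d (T : measurableType d) (mu : {measure set T -> \bar R})
    I (r : seq I) (f : I -> T -> R) :
  (forall i, mu.-integrable setT (EFin \o f i)) ->
  mu.-integrable setT (EFin \o (fun x => \sum_(i <- r) f i x)) /\
  \int[mu]_x (\sum_(i <- r) f i x) = \sum_(i <- r) \int[mu]_x f i x.
Proof.
move=> fi.
have sum_i : forall r : seq I,
    mu.-integrable setT (EFin \o (fun x => \sum_(i <- r) f i x)).
  move=> r'.
  rewrite (_ : EFin \o _ = fun x => (\sum_(i <- r') (EFin \o f i) x)%E).
    exact: integrable_sum.
  by apply/funext => x /=; rewrite sumEFin.
split; first exact: sum_i.
elim: r => [|i r IH].
  under eq_Rintegral do rewrite big_nil.
  by rewrite Rintegral_cst // mul0r big_nil.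
by under eq_Rintegral do rewrite big_cons; rewrite RintegralD // IH big_cons.
Qed.
End Limits.

(** * Translations, integrability and left invariance of the integral *)

Section Haar.
Context {R : realType} {G : groupTopType}.
Context (nu : probability (borel G) R).
Context (cG : compact_group G) (haar_nu : haar_probability nu).

Lemma continuous_lmul (a : G) : continuous (fun x : G => (a * x)%g).
Proof.
have [_ _ cM _] := cG.
move=> x; apply: (continuous_comp (f := fun x => (a, x))
  (g := fun p : G * G => (p.1 * p.2)%g)).
  by apply: cvg_pair; [exact: cvg_cst | exact: cvg_id].
exact: cM.
Qed.

Lemma continuous_rmul (a : G) : continuous (fun x : G => (x * a)%g).
Proof.
have [_ _ cM _] := cG.
move=> x; apply: (continuous_comp (f := fun x => (x, a))
  (g := fun p : G * G => (p.1 * p.2)%g)).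
  by apply: cvg_pair; [exact: cvg_id | exact: cvg_cst].
exact: cM.
Qed.

Lemma continuous_translate (h : G -> R) (a b : G) :
  continuous h -> continuous (fun x => h (a * x * b)%g).
Proof.
move=> ch x.
apply: (continuous_comp (f := fun x => (a * x * b)%g) (g := h)); last exact: ch.
apply: (continuous_comp (f := fun x => (a * x)%g) (g := fun x => (x * b)%g)).
- exact: continuous_lmul.
- exact: continuous_rmul.
Qed.

Lemma borel_continuous (h : G -> R) :
  continuous h -> measurable_fun setT (h : borel G -> R).
Proof.
move=> /continuousP ch.
apply: (measurability _ (measurable_realfun.RGenOpens.measurableE R)).
move=> _ [_ [a [b ->]] <-]; rewrite setTI.
by apply: sub_sigma_algebra; apply: ch; exact: interval_open.
Qed.

Lemma continuous_integrable (h : G -> R) (M : R) : continuous h ->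
  (forall x, `|h x| <= M) -> nu.-integrable setT (EFin \o (h : borel G -> R)).
Proof.
move=> ch hM; apply: measurable_bounded_integrable => //.
- exact: le_lt_trans (probability_le1 nu measurableT) (ltry 1).
- exact: borel_continuous.
- exists M; split; first exact: num_real.
  by move=> y My x _ /=; exact: le_trans (hM x) (ltW My).
Qed.

(** The left side is the integral of [h] against the pushforward of [nu] by x -> a x, which is [nu]
    because the preimage of E is a^-1 E. *)
Lemma Rintegral_lmul (h : G -> R) (M : R) (a : G) : continuous h ->
  (forall x, `|h x| <= M) -> \int[nu]_x h (a * x)%g = \int[nu]_x h x.
Proof.
move=> ch hM; have [linv _ _] := haar_nu.
have ma : measurable_fun setT ((fun x : G => (a * x)%g) : borel G -> borel G).
  apply: (measurability (@open G : set (set (borel G)))) => // _ [U oU <-].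
  rewrite setTI; apply: sub_sigma_algebra; apply: open_comp => // x _.
  exact: continuous_lmul.
have cah : continuous (fun x => h (a * x)%g).
  by under eq_fun do rewrite -[(a * _)%g]mulg1; exact: continuous_translate.
congr fine.
rewrite -[LHS](@integral_pushforward _ _ _ _ R _ ma nu setT (EFin \o h)) //=.
- apply: (eq_measure_integral nu) => E mE _ /=.
  rewrite /pushforward.
  have -> : (fun x : G => (a * x)%g) @^-1` E = [set (a^-1 * x)%g | x in E].
    apply/seteqP; split=> [x /= Eax|_ [x Ex <-]] /=; last by rewrite mulVKg.
    by exists (a * x)%g => //; rewrite mulKg.
  exact: linv.
- by apply/measurable_realfun.measurable_EFinP; exact: borel_continuous.
- rewrite preimage_setT.
  exact: (@continuous_integrable (fun x => h (a * x)%g) M).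
Qed.
End Haar.

Lemma Rintegral_dist_le (R : realType) d (T : measurableType d)
    (P : probability T R) (f g : T -> R) (C : R) :
  P.-integrable setT (EFin \o f) -> P.-integrable setT (EFin \o g) ->
  (forall x, `|f x - g x| <= C) -> `|\int[P]_x f x - \int[P]_x g x| <= C.
Proof.
move=> fi gi fgC; rewrite -RintegralB //.
have fgi : P.-integrable setT (EFin \o (fun x => f x - g x)).
  rewrite (_ : EFin \o _ = (EFin \o f) \- (EFin \o g))%E //.
  exact: integrableB.
apply: (le_trans (le_normr_Rintegral _ fgi)) => //.
have -> : C = \int[P]_x C.
  rewrite Rintegral_cst // (_ : fine _ = 1) ?mulr1 //.
  exact: (congr1 fine (@probability_setT _ _ _ P)).
apply: le_Rintegral => //; first exact: (integrable_norm fgi).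
exact: finite_measure_integrable_cst.
Qed.

(** * Right invariance of the integral *)

Section RightInvariance.
Context {R : realType} {G : groupTopType}.
Context (nu : probability (borel G) R).
Context (cG : compact_group G) (haar_nu : haar_probability nu).

Lemma translate_integrable (h : G -> R) (a b : G) : continuous h -> sym_pd h ->
  nu.-integrable setT (EFin \o (fun x : borel G => h (a * x * b)%g)).
Proof.
move=> ch hpd.
apply: (@continuous_integrable _ _ _ (fun x => h (a * x * b)%g) (h 1%g)).
  exact: continuous_translate.
by move=> x; exact: sym_pd_le.
Qed.

(** The integrand is the weighted average of the left translates h(p^-1 x v), all with the same
    integral. *)
Lemma Rintegral_left_average (h : G -> R) (s : seq (R * G)) (v : G) :
  continuous h -> sym_pd h -> \sum_(p <- s) p.1 = 1 ->
  nu.-integrable setT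
    (EFin \o (fun x : borel G => gram h s [:: (1, (x * v)%g)])) /\
  \int[nu]_x gram h s [:: (1, (x * v)%g)] = \int[nu]_x h (x * v)%g.
Proof.
move=> ch hpd s1.
pose f (p : R * G) (x : borel G) := p.1 * h (p.2^-1 * x * v)%g.
have gE : (fun x : borel G => gram h s [:: (1, (x * v)%g)]) =
    (fun x => \sum_(p <- s) f p x).
  apply/funext => x; apply: eq_bigr => p _.
  by rewrite big_seq1 mulr1 /f mulgA.
have fi p : nu.-integrable setT (EFin \o f p).
  rewrite (_ : EFin \o _ =
    fun x => (p.1%:E * (EFin \o (fun x => h (p.2^-1 * x * v)%g)) x)%E) //.
  by apply: integrableZl => //; exact: translate_integrable.
have [si sE] := Rintegral_bigsum s fi.
rewrite gE; split => //; rewrite sE.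
have fE p : \int[nu]_x f p x = p.1 * \int[nu]_x h (x * v)%g.
  rewrite RintegralZl //; last exact: translate_integrable.
  congr (_ * _).
  apply: (@Rintegral_lmul _ _ nu cG haar_nu (fun x => h (x * v)%g) (h 1%g)).
    under eq_fun do rewrite -[X in h (X * _)%g]mul1g.
    exact: continuous_translate.
  by move=> x; exact: sym_pd_le.
by under eq_bigr do rewrite fE; rewrite -mulr_suml s1 mul1r.
Qed.

(* Unimodularity, for positive definite functions only: near-minimal convex
   combinations of left translates of h are almost constant on G, and
   averaging over left translates changes neither integral. *)
Lemma Rintegral_rmul (h : G -> R) (v : G) : continuous h -> sym_pd h ->
  \int[nu]_x h (x * v)%g = \int[nu]_x h x.
Proof.
move=> ch hpd.
have [s Ps sP] := @min_gram_seq R G setT h hpd I (fun _ _ _ _ => I).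
apply: (@eq_of_invSn_mul _ _ _ ((1 + h 1%g) / 2)) => n.
have [_ _ s1] := Ps n.
have [iv <-] := Rintegral_left_average v ch hpd s1.
have [i1] := Rintegral_left_average 1%g ch hpd s1.
under [X in _ = X -> _]eq_Rintegral do rewrite mulg1.
move=> <-; apply: Rintegral_dist_le => // x; rewrite mulg1 mulrA.
(* Translation by x v^-1 x^-1 carries x v to x, so the difference pairs pi(x)xi with a translate of
   [s n] minus [s n], which is small uniformly in the translation. *)
have -> : gram h (s n) [:: (1, (x * v)%g)] - gram h (s n) [:: (1, x)] =
  gram h (wsub (wshift (x * v^-1 * x^-1)%g (s n)) (s n)) [:: (1, x)].
  rewrite gram_subl; congr (_ - _).
  rewrite -[RHS](gram_shift h (x * v * x^-1)%g) -wshiftM !mulgA.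
  by rewrite mulgVK mulgK mulgV wshift1 /wshift /= mulgVK.
apply: gram_bound => //; first exact: sP.
by rewrite /gram !big_seq1 /= mulVg !mul1r.
Qed.
End RightInvariance.

(** * Construction of the bi-invariant limit *)

Lemma invariant_limit (R : realType) (G : groupType) (h : G -> R) (W : set G) :
  sym_pd h -> W 1%g -> (forall w v, W w -> W v -> W (w * v)%g) ->
  (forall w, W w -> W (w^-1)%g) ->
  exists (h' : G -> R) (s : nat -> seq (R * G)),
    [/\ forall n, prob_on W (s n),
        forall n g, `|h' g - avg h (s n) g| <= n.+1%:R^-1 * (1 + h 1%g) &
        forall g w, W w -> h' (w * g)%g = h' g /\ h' (g * w)%g = h' g].
Proof.
move=> hpd W1 WM WV; have [s Ps sP] := min_gram_seq hpd W1 WM.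
(* This one estimate serves twice: v = w = e makes the sequence uniformly Cauchy, and general v, w
   yield invariance of the limit. *)
have close n k v g w : (n <= k)%N -> W v -> W w ->
    `|avg h (s k) (v * g * w)%g - avg h (s n) g| <= n.+1%:R^-1 * (1 + h 1%g).
  move=> nk Wv Ww; apply: (avg_dist (W := W)) => //; last exact: WV.
  by move=> u; exact: sP.
have close1 n k g : (n <= k)%N ->
    `|avg h (s k) g - avg h (s n) g| <= n.+1%:R^-1 * (1 + h 1%g).
  move=> nk; rewrite -[X in avg h (s k) X]mul1g -[X in avg h (s k) X]mulg1.
  exact: close.
have cvg_avg g : cvgn (fun k => avg h (s k) g).
  apply/cauchy_cvgP/cauchy_exP => e e0.
  have [n ne] := invSn_mul_lt (1 + h 1%g) e0.
  exists (avg h (s n) g); exists n => // k /= nk.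
  by rewrite /ball /= distrC; apply: le_lt_trans ne; exact: close1.
pose h' g := limn (fun k => avg h (s k) g).
have h'P n v g w : W v -> W w ->
    `|h' (v * g * w)%g - avg h (s n) g| <= n.+1%:R^-1 * (1 + h 1%g).
  move=> Wv Ww.
  have c : (fun k => `|avg h (s k) (v * g * w)%g - avg h (s n) g|) @ \oo -->
      `|h' (v * g * w)%g - avg h (s n) g|.
    by apply: cvg_norm; apply: cvgB; [exact: cvg_avg|exact: cvg_cst].
  rewrite -(cvg_lim (@Rhausdorff _) c); apply: limr_le.
    by apply/cvg_ex; eexists; exact: c.
  by exists n => // k /= nk; exact: close.
have h'1 n g : `|h' g - avg h (s n) g| <= n.+1%:R^-1 * (1 + h 1%g).
  by rewrite -[X in h' X]mul1g -[X in h' X]mulg1; exact: h'P.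
exists h', s; split => // g w Ww; split.
(* The values of [h'] at the translated point and at g are both close to [avg h (s n) g], hence the
   factor 2. *)
all: apply: (@eq_of_invSn_mul _ _ _ (2 * (1 + h 1%g))) => n.
- have := h'P n w g 1%g Ww W1; have := h'1 n g; rewrite mulg1.
  move=> A1 A2; rewrite (le_trans (ler_distD (avg h (s n) g) _ _)) //.
  rewrite [X in _ + X]distrC; by rewrite mulrCA mulr2n mulrDl mul1r lerD.
- have := h'P n 1%g g w W1 Ww; have := h'1 n g; rewrite mul1g.
  move=> A1 A2; rewrite (le_trans (ler_distD (avg h (s n) g) _ _)) //.
  rewrite [X in _ + X]distrC; by rewrite mulrCA mulr2n mulrDl mul1r lerD.
Qed.

(** * Feasibility of the averages and of their uniform limits *)

Section Averages.
Context {R : realType} {G : groupTopType}.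
Context (nu : probability (borel G) R).
Context (cG : compact_group G) (haar_nu : haar_probability nu).

Lemma continuous_avg (h : G -> R) s : continuous h -> continuous (avg h s).
Proof.
move=> ch; rewrite (_ : avg h s = fun g =>
    \sum_(p <- s) \sum_(q <- s) p.1 * q.1 * h (p.2^-1 * g * q.2)%g); last first.
  by apply/funext => g; exact: avg_sum.
do 2!(apply: (continuous_big add_continuous) => ? _); move=> x.
apply: cvgM; [exact: cvg_cst|exact: continuous_translate].
Qed.

Lemma sym_pd_integrable (h : G -> R) : continuous h -> sym_pd h ->
  nu.-integrable setT (EFin \o (h : borel G -> R)).
Proof.
by move=> ch hpd; apply: continuous_integrable ch _ => x; exact: sym_pd_le.
Qed.

Lemma Rintegral_avg (h : G -> R) W s :
  continuous h -> sym_pd h -> prob_on W s ->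
  \int[nu]_x avg h s x = \int[nu]_x h x.
Proof.
move=> ch hpd [_ _ s1].
pose f (p q : R * G) (x : borel G) := p.1 * q.1 * h (p.2^-1 * x * q.2)%g.
have fi p q : nu.-integrable setT (EFin \o f p q).
  rewrite (_ : EFin \o _ = fun x => ((p.1 * q.1)%:E *
    (EFin \o (fun x => h (p.2^-1 * x * q.2)%g)) x)%E) //.
  by apply: integrableZl => //; exact: translate_integrable.
have fE p q : \int[nu]_x f p q x = p.1 * q.1 * \int[nu]_x h x.
  rewrite RintegralZl //; last exact: translate_integrable.
  congr (_ * _); rewrite -(@Rintegral_rmul _ _ nu cG haar_nu h q.2 ch hpd).
  apply: (@Rintegral_lmul _ _ nu cG haar_nu (fun x => h (x * q.2)%g) (h 1%g)).
    under eq_fun do rewrite -[X in h (X * _)%g]mul1g.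
    exact: continuous_translate.
  by move=> x; exact: sym_pd_le.
have -> : avg h s = (fun x => \sum_(p <- s) \sum_(q <- s) f p q x).
  by apply/funext => x; exact: avg_sum.
have [_ ->] := Rintegral_bigsum s (fun p => (Rintegral_bigsum s (fi p)).1).
under eq_bigr do rewrite (Rintegral_bigsum s (fi _)).2.
under eq_bigr do under eq_bigr do rewrite fE.
under eq_bigr do rewrite -mulr_suml -mulr_sumr s1 mulr1.
by rewrite -mulr_suml s1 mul1r.
Qed.

(** If p^-1 g q were in A, then g would be in p A q^-1 = A; so every term evaluates [h] outside
    A. *)
Lemma avg_nonpos (h : G -> R) (A W : set G) s g :
  (forall x, ~ A x -> h x <= 0) ->
  (forall w, W w -> W (w^-1)%g) ->
  (forall w : G, W w ->
     [set (w * a)%g | a in A] = A /\ [set (a * w)%g | a in A] = A) ->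
  prob_on W s -> ~ A g -> avg h s g <= 0.
Proof.
move=> hA WV WA [s0 sW _] nAg; rewrite avg_sum.
rewrite big_seq; apply: sumr_le0 => p sp.
rewrite big_seq; apply: sumr_le0 => q sq.
apply: mulr_ge0_le0; first by rewrite mulr_ge0 ?s0.
apply: hA => Apgq; apply: nAg.
have [WpA _] := WA _ (sW _ sp); have [_ WqA] := WA _ (WV _ (sW _ sq)).
rewrite -WpA; exists (p.2^-1 * g)%g; last by rewrite mulVKg.
by rewrite -WqA; exists (p.2^-1 * g * q.2)%g; rewrite ?mulgK.
Qed.

Lemma cvg_uniform_limit (f : nat -> G -> R) (h : G -> R) (C : R) :
  (forall n g, `|h g - f n g| <= n.+1%:R^-1 * C) ->
  forall g, f n g @[n --> \oo] --> h g.
Proof.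
move=> hf g; apply/cvgrPdist_le => e e0.
have [N Ne] := invSn_mul_lt C e0.
exists N => // n /= Nn; apply: le_trans (hf n g) _.
apply: le_trans (ltW Ne); apply: ler_wpM2r.
  (* The bound at n = 0 forces C >= 0. *)
  have := le_trans (normr_ge0 _) (hf 0%N g); by rewrite invr1 mul1r.
by rewrite lef_pV2 ?posrE // ler_nat ltnS.
Qed.

(** Each condition involves finitely many values of the function, so it passes to pointwise
    limits. *)
Lemma sym_pd_uniform_limit (f : nat -> G -> R) (h : G -> R) (C : R) :
  (forall n, sym_pd (f n)) ->
  (forall n g, `|h g - f n g| <= n.+1%:R^-1 * C) -> sym_pd h.
Proof.
move=> fpd hf.
have cf := cvg_uniform_limit hf.
split=> [x|t].
  apply: (@cvg_unique _ (@Rhausdorff R) _ _ _ _ (cf (x^-1)%g) _).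
  rewrite (_ : (fun n => f n (x^-1)%g) = (fun n => f n x)); first exact: cf.
  by apply/funext => n; rewrite (fpd n).1.
have cg : gram (f n) t t @[n --> \oo] --> gram h t t.
  do 2!(apply: (cvg_big add_continuous) => ? _);
  apply: cvgM; [exact: cvg_cst | exact: cf].
rewrite -(cvg_lim (@Rhausdorff _) cg); apply: limr_ge.
  by apply/cvg_ex; eexists; exact: cg.
by apply: nearW => n; exact: (fpd n).2.
Qed.

Lemma continuous_uniform_limit (f : nat -> G -> R) (h : G -> R) (C : R) :
  (forall n, continuous (f n)) ->
  (forall n g, `|h g - f n g| <= n.+1%:R^-1 * C) -> continuous h.
Proof.
move=> fc hf x; apply/cvgrPdist_lt => e e0.
have [n ne] := invSn_mul_lt C (divr_gt0 e0 (ltr0n _ 3)).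
have := fc n x; move=> /cvgrPdist_lt /(_ _ (divr_gt0 e0 (ltr0n _ 3))).
apply: filterS => y xy; have := hf n x; have := hf n y; move: xy ne.
move: (_ * C) (h x) (h y) (f n x) (f n y) => c a b a' b'.
rewrite !(ltr_norml, ler_norml) => /andP[? ?] ? /andP[? ?] /andP[? ?].
by apply/andP; split; lra.
Qed.
End Averages.

(** * Comparison of the two infima *)

Theorem theoremA1 (R : realType) (G : groupTopType)
  (nu : probability (borel G) R) (A W : set G) :
  compact_group G ->
  haar_probability nu ->
  [set (a^-1)%g | a in A] = A ->
  A 1%g ->
  W 1%g ->
  (forall w v : G, W w -> W v -> W (w * v)%g) ->
  (forall w : G, W w -> W (w^-1)%g) ->
  closed W ->
  (forall w : G, W w ->
     [set (w * a)%g | a in A] = A /\ [set (a * w)%g | a in A] = A) ->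
  B_value nu A = B_value_inv nu A W.
Proof.
move=> cG haar_nu _ _ W1 WM WV _ WA.
apply/eqP; rewrite eq_le; apply/andP; split.
  by apply: ereal_inf_le_tmp => _ [h [hF _] <-]; exists h.
(* Each feasible [h] is matched by an invariant feasible [h'] with h'(e) <= h(e). *)
apply: le_ereal_inf_tmp => _ [h [[ch /positive_definite_real hpd] hA h1] <-].
have [h' [s [Ps hs hW]]] := invariant_limit hpd W1 WM WV.
have apd n : sym_pd (avg h (s n)) by exact: sym_pd_avg.
have ac n : continuous (avg h (s n)) by exact: continuous_avg.
have h'pd := sym_pd_uniform_limit apd hs.
have h'c := continuous_uniform_limit ac hs.
have cvg_avg g : avg h (s n) g @[n --> \oo] --> h' g.
  by apply: (cvg_uniform_limit hs).
apply: ge_ereal_inf; exists (h' 1%g)%:E.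
  exists h' => //; split => //; split.
  - by split; [|apply/positive_definite_real].
  - move=> g nAg; rewrite -(cvg_lim (@Rhausdorff _) (cvg_avg g)).
    apply: limr_le.
      by apply/cvg_ex; eexists; exact: cvg_avg.
    by apply: nearW => n; exact: (avg_nonpos hA WV WA (Ps n) nAg).
  - have hi := sym_pd_integrable nu ch hpd.
    have h'i := sym_pd_integrable nu h'c h'pd.
    rewrite -h1 -[LHS]fineK ?(integrable_fin_num _ h'i) //.
    rewrite -[RHS]fineK ?(integrable_fin_num _ hi) //.
    (* Every average has the integral of [h] and is uniformly close to [h']. *)
    congr EFin; apply: (@eq_of_invSn_mul _ _ _ (1 + h 1%g)) => n.
    have := Rintegral_avg cG haar_nu ch hpd (Ps n); rewrite /Rintegral => <-.
    by apply: Rintegral_dist_le; [exact: h'i | exact: sym_pd_integrable |].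
rewrite lee_fin -(cvg_lim (@Rhausdorff _) (cvg_avg 1%g)); apply: limr_le.
  by apply/cvg_ex; eexists; exact: cvg_avg.
(* At e the average is the square norm of a convex combination of orbit vectors, each of square norm
   h(e). *)
apply: nearW => n; rewrite /avg wshift1; exact: prob_on_gram_le (Ps n).
Qed.
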